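(* Let $\mathcal{G}=(\mathcal{N},\mathcal{E})$ be the velocity graph built from $N$ waypoints and $M$ sampled velocities per intermediate waypoint, and let $\mathcal{G}_{mp}=(\mathcal{N}_{mp},\mathcal{E}_{mp})$ be the motion primitive graph on the same waypoints and sampled velocities using Linear Quadratic Minimum Time (LQMT) motion primitives with free terminal acceleration for a triple integrator. Then $\mathcal{G}_{mp}$ has size identical to $\mathcal{G}$: $|\mathcal{N}_{mp}|=|\mathcal{N}|$ and $|\mathcal{E}_{mp}|=|\mathcal{E}|$.
   Context: **Velocity graph $\mathcal{G}$.** Let $\boldsymbol{w}_1,\dots,\boldsymbol{w}_N\in\mathbb{R}^3$ be an ordered list of waypoints ($N\ge2$). At each intermediate waypoint $\boldsymbol{w}_i$ ($2\le i\le N-1$) there are $M$ distinct sampled velocities, and each pair (waypoint index, sampled velocity) is a node. At the first waypoint there is exactly one node (the start node) and at the last waypoint exactly one node (the goal node), each with a given velocity. There is exactly one directed edge from each node at $\boldsymbol{w}_i$ to each node at $\boldsymbol{w}_{i+1}$, $1\le i\le N-1$, and no other edges. **LQMT motion primitive for a triple integrator with free terminal acceleration (one axis; repeated for the three axes).** Given initial position, velocity and acceleration $s_0,v_0,a_0$ and terminal position and velocity $s_f,v_f$, it is the solution of $\min_{T,u}\ \rho T+\int_0^T u^2\,dt$ subject to $s^{(3)}=u$, $s(0)=s_0$, $\dot s(0)=v_0$, $\ddot s(0)=a_0$, $s(T)=s_f$, $\dot s(T)=v_f$, with $\ddot s(T)$ free and $\rho>1$. **Motion primitive graph $\mathcal{G}_{mp}$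 (with greedy pre-processing).** Its nodes are waypoint-velocity-acceleration states, with exactly one acceleration value retained for each waypoint-velocity pair that is a node of $\mathcal{G}$: at the start node the given initial acceleration, and at every other node the free terminal acceleration attained by the selected best incoming (parent) primitive. From each node at $\boldsymbol{w}_i$, exactly one LQMT primitive (edge) is generated to each waypoint-velocity pair at $\boldsymbol{w}_{i+1}$, using the node's retained acceleration as initial acceleration; the edge leads to the unique node of $\mathcal{G}_{mp}$ with that waypoint-velocity pair. The size is counted before any pruning of primitives for collisions or constraint violations. *)

(* Defs.v *)
From HB Require Import structures.
From mathcomp Require Import all_boot all_order all_algebra.
From mathcomp Require Import all_classical all_reals all_analysis.

Set Implicit Arguments.
Unset Strict Implicit.
Unset Printing Implicit Defensive.

Import Order.TTheory GRing.Theory Num.Theory.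
Import numFieldNormedType.Exports.

Local Open Scope classical_set_scope.
Local Open Scope ring_scope.

(* Possibly parallel edges are distinguished by the values in E, so that the
   cardinal of [edges] counts every edge. *)
Record graph (V E : Type) := Graph { nodes : set V; edges : set E }.

(* Waypoints are indexed from 0: the first one has index 0, the last one N - 1.
   Only the values of [sample] at intermediate waypoints are used. *)
Record planning_data (R : realType) (N M : nat) := PlanningData {
  waypoint : 'I_N -> 'rV[R]_3;
  start_velocity : 'rV[R]_3;
  goal_velocity : 'rV[R]_3;
  start_acceleration : 'rV[R]_3;
  sample : 'I_N -> 'I_M -> 'rV[R]_3;
  sample_inj : forall i : 'I_N, (0 < i)%N -> (i.+1 < N)%N ->
    injective (sample i) }.

Section VelocityGraph.
Context (R : realType) (N M : nat) (D : planning_data R N M).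

Definition velocities (i : 'I_N) : set 'rV[R]_3 :=
  if i == 0%N :> nat then [set start_velocity D]
  else if i.+1 == N then [set goal_velocity D]
  else range (sample D i).

Definition velocity_graph :
    graph ('I_N * 'rV[R]_3) (('I_N * 'rV[R]_3) * ('I_N * 'rV[R]_3)) :=
  let nds : set ('I_N * 'rV[R]_3) := [set x | velocities x.1 x.2] in
  Graph nds
    [set e | [/\ nds e.1, nds e.2 & e.2.1 = e.1.1.+1 :> nat]].

End VelocityGraph.

Section LQMT.
Context (R : realType).
Notation mu := (@lebesgue_measure R).

Record axis_motion := AxisMotion {
  ctrl : R -> R; pos : R -> R; vel : R -> R; acc : R -> R }.

(* s = pos, s' = vel, s'' = acc and s''' = u = ctrl on [0, T], with u in
   L^2([0, T]). For such controls s''' = u means that s'' is the indefinite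
   integral of u (absolutely continuous with derivative u a.e.). The terminal
   acceleration [acc m T] is not constrained. The value T = 0 is allowed: it is
   feasible only when (s0, v0) = (sf, vf), and then it is the minimizer. *)
Record axis_admissible (s0 v0 a0 sf vf T : R) (m : axis_motion) : Prop :=
  AxisAdmissible {
    duration_ge0 : 0 <= T;
    ctrl_measurable : measurable_fun `[0, T] (ctrl m);
    ctrl_square_integrable :
      mu.-integrable `[0, T] (fun t => (ctrl m t ^+ 2)%:E);
    pos_continuous : {within `[0, T], continuous (pos m)};
    vel_continuous : {within `[0, T], continuous (vel m)};
    pos_derive : forall t, t \in `]0, T[ -> is_derive t 1 (pos m) (vel m t);
    vel_derive : forall t, t \in `]0, T[ -> is_derive t 1 (vel m) (acc m t);
    acc_primitive : forall t, t \in `[0, T] ->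
      acc m t = acc m 0 + \int[mu]_(x in `[0, t]) ctrl m x;
    pos_init : pos m 0 = s0;
    vel_init : vel m 0 = v0;
    acc_init : acc m 0 = a0;
    pos_final : pos m T = sf;
    vel_final : vel m T = vf }.

Definition effort (T : R) (m : axis_motion) : R :=
  \int[mu]_(t in `[0, T]) ctrl m t ^+ 2.

Definition axis_lqmt (rho s0 v0 a0 sf vf T : R) (m : axis_motion) : Prop :=
  axis_admissible s0 v0 a0 sf vf T m /\
  forall T' m', axis_admissible s0 v0 a0 sf vf T' m' ->
    rho * T + effort T m <= rho * T' + effort T' m'.

Record primitive := Primitive {
  duration : 'I_3 -> R; motion : 'I_3 -> axis_motion }.

Definition terminal_acceleration (p : primitive) : 'rV[R]_3 :=
  \row_k acc (motion p k) (duration p k).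

(* The problem repeated for the three axes: either the one-axis problem is
   solved on each axis separately ([common = false]), or the axes share one
   duration T and minimize rho T + \int_0^T |u|^2 jointly ([common = true]). *)
Definition lqmt_primitive (common : bool) (rho : R)
    (s0 v0 a0 sf vf : 'rV[R]_3) (p : primitive) : Prop :=
  let admissible k T m := axis_admissible
    (s0 ord0 k) (v0 ord0 k) (a0 ord0 k) (sf ord0 k) (vf ord0 k) T m in
  if common then
    exists T : R,
      [/\ forall k, duration p k = T,
          forall k, admissible k T (motion p k) &
          forall T' (m' : 'I_3 -> axis_motion),
            (forall k, admissible k T' (m' k)) ->
            rho * T + \sum_(k < 3) effort T (motion p k) <=
            rho * T' + \sum_(k < 3) effort T' (m' k)]
  else
    forall k, axis_lqmt rho (s0 ord0 k) (v0 ord0 k) (a0 ord0 k)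
      (sf ord0 k) (vf ord0 k) (duration p k) (motion p k).

End LQMT.

Section MotionPrimitiveGraph.
Context (R : realType) (N M : nat) (D : planning_data R N M).

Record state := State {
  index : 'I_N; velocity : 'rV[R]_3; acceleration : 'rV[R]_3 }.

Definition waypoint_velocity (x : state) : 'I_N * 'rV[R]_3 :=
  (index x, velocity x).

Record mp_edge := MpEdge { src : state; prim : primitive R; tgt : state }.

(* [score x p] is the quantity, e.g. the cost-to-come of x plus the cost of p,
   whose minimization selects the best primitive p from a parent x. The state
   reached by an edge agrees with the end of its primitive in position and
   velocity; its acceleration is the one retained from the best parent. *)
Record is_motion_primitive_graph (common : bool) (rho : R)
    (score : state -> primitive R -> R) (H : graph state mp_edge) : Prop :=
  IsMotionPrimitiveGraph {
    mp_nodes_sub : forall x, nodes H x ->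
      nodes (velocity_graph D) (waypoint_velocity x);
    mp_retained : forall y, nodes (velocity_graph D) y ->
      exists! x, nodes H x /\ waypoint_velocity x = y;
    mp_start : forall x, nodes H x -> index x = 0%N :> nat ->
      acceleration x = start_acceleration D;
    mp_best_parent : forall x, nodes H x -> (0 < index x)%N ->
      exists e, [/\ edges H e, tgt e = x,
        forall e', edges H e' -> tgt e' = x ->
          score (src e) (prim e) <= score (src e') (prim e') &
        acceleration x = terminal_acceleration (prim e)];
    mp_edges_sub : forall e, edges H e ->
      [/\ nodes H (src e), nodes H (tgt e),
          index (tgt e) = (index (src e)).+1 :> nat &
          lqmt_primitive common rho
            (waypoint D (index (src e))) (velocity (src e))
            (acceleration (src e))
            (waypoint D (index (tgt e))) (velocity (tgt e)) (prim e)];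
    mp_edges_unique : forall x y, nodes H x -> nodes (velocity_graph D) y ->
      y.1 = (index x).+1 :> nat ->
      exists! e, [/\ edges H e, src e = x & waypoint_velocity (tgt e) = y] }.

End MotionPrimitiveGraph.

(* Main.v *)
Require Import Defs.
From mathcomp Require Import all_boot all_order all_algebra.
From mathcomp Require Import all_classical all_reals all_analysis.
Import Order.TTheory GRing.Theory Num.Theory.
Local Open Scope classical_set_scope.
Local Open Scope card_scope.
Local Open Scope ring_scope.

(** Forgetting accelerations and primitives projects [Gmp] onto the velocity graph. This is
    bijective on nodes, since each waypoint-velocity pair retains one acceleration, and on edges,
    since each node emits one primitive to each pair at the next waypoint. [unique_preimage_card_eq]
    turns both into equal cardinals. *)

Lemma unique_preimage_card_eq (T U : Type) (A : set T) (B : set U) (f : T -> U) :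
  (forall x, A x -> B (f x)) ->
  (forall y, B y -> exists! x, A x /\ f x = y) -> (A #= B)%card.
Proof.
move=> fAB fU; have fI : {in A &, injective f}.
  move=> x x'; rewrite !inE => Ax Ax' eq_f.
  (* Both points equal the unique preimage [z] of their common image. *)
  have [z [_ zU]] := fU _ (fAB _ Ax).
  by rewrite -(zU x (conj Ax erefl)) -(zU x' (conj Ax' (esym eq_f))).
have <- : f @` A = B.
  apply/seteqP; split=> [_ [x Ax <-]|y /fU[x [[Ax <-] _]]]; first exact: fAB.
  by exists x.
by rewrite card_eq_sym; apply: inj_card_eq.
Qed.

Theorem corollary1 (R : realType) (N M : nat) (hN : (2 <= N)%N)
    (D : planning_data R N M) (rho : R) (hrho : 1 < rho) (common : bool)
    (score : state R N -> primitive R -> R)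
    (Gmp : graph (state R N) (mp_edge R N))
    (hGmp : is_motion_primitive_graph D common rho score Gmp) :
  (nodes Gmp #= nodes (velocity_graph D)) /\
  (edges Gmp #= edges (velocity_graph D)).
Proof.
have [nsub nret _ _ esub eret] := hGmp; split.
  exact: unique_preimage_card_eq nsub nret.
pose endpoints (e : mp_edge R N) :=
  (waypoint_velocity (src e), waypoint_velocity (tgt e)).
apply: (@unique_preimage_card_eq _ _ _ _ endpoints).
  by move=> e /esub[ns nt idx _]; split; [exact: nsub|exact: nsub|].
move=> [y z] [/= Vy Vz yz].
(* The only possible source over [y] is its retained state [x]; the edge sought is the one primitive
   from [x] towards [z]. *)
have [x [[nx wx] xU]] := nret y Vy.
have zx : z.1 = (waypoint_velocity x).1.+1 :> nat by rewrite wx.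
have [e [[Ee se te] eU]] := eret x z nx Vz zx.
exists e; split; first by split=> //; rewrite /endpoints se te wx.
(* A rival edge only has a source lying over [y]; that source is a node of [Gmp], so uniqueness of
   the retained acceleration makes it [x]. *)
move=> e' [Ee' [sy tz]]; apply: eU; split=> //.
by apply/esym/xU; split=> //; have [] := esub _ Ee'.
Qed.
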